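(* Let $\mathcal{X}$ be a set, $E$ a Banach space, and let $\mathcal{B}$ be a GRKBS of functions $\mathcal{X}\to E$ with configuration $(\mathcal{F},\phi)$. Then $\mathcal{B}$ is a two-sided GRKBS, with $\Omega=\mathcal{X}$ and $\Omega'=\mathcal{F}/\mathcal{N}_\phi$, whose (two-sided) reproducing kernel can be taken to be $\mathcal{K}:\mathcal{X}\times\mathcal{F}/\mathcal{N}_\phi\to E$ defined by $$\mathcal{K}(x,\mu+\mathcal{N}_\phi)=\phi_*(\mu+\mathcal{N}_\phi)(x)=f_\mu(x)=\phi(x)(\mu).$$
   Context: $L_{\mathrm{op}}(\mathcal{F},E)$ denotes the bounded linear operators from $\mathcal{F}$ to $E$ with the operator norm. A GRKBS is a Banach space $\mathcal{B}$ of functions $f:\mathcal{X}\to E$ (pointwise operations) for which every evaluation operator $ev_x(f)=f(x)$ is bounded from $\mathcal{B}$ to $E$. A configuration (generating structure) of $\mathcal{B}$ is a pair $(\mathcal{F},\phi)$ with $\mathcal{F}$ a Banach space and $\phi:\mathcal{X}\to L_{\mathrm{op}}(\mathcal{F},E)$ such that $\mathcal{B}=\{f_\mu:\mu\in\mathcal{F}\}$, $f_\mu(x)=\phi(x)(\mu)$, and $\|f\|_{\mathcal{B}}=\inf\{\|\mu\|_{\mathcal{F}}:f=f_\mu\}$. Put $\mathcal{N}_\phi=\bigcap_{x\in\mathcal{X}}\ker\phi(x)$; $\mathcal{F}/\mathcal{N}_\phi$ carries the quotient norm (and its topology), and $\phi_*:\mathcal{F}/\mathcal{N}_\phi\to\mathcal{B}$,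 $\phi_*(\mu+\mathcal{N}_\phi)=f_\mu$, is an isometric isomorphism. Left-/right-/two-sided GRKBS: let $\Omega$ be a set, $\Omega'$ a Hausdorff topological space, $\mathcal{B}$ a Banach space of functions $f:\Omega\to E$, and $K:\Omega\times\Omega'\to E$ a function such that for every $x\in\Omega$ the function $K(x,\cdot)$ is (Borel) measurable on $\Omega'$. $\mathcal{B}$ is a left-sided GRKBS with left-sided reproducing kernel $K$ if: (i) there exist a normed vector space $\mathcal{G}$ of functions $g:\Omega'\to E$ with $K(x,\cdot)\in\mathcal{G}$ for all $x\in\Omega$, and an isometric isomorphism $\mathcal{J}:\mathcal{G}\to L_{\mathrm{op}}(\mathcal{B},E)$; (ii) $f(x)=\mathcal{J}[K(x,\cdot)](f)$ for all $x\in\Omega$ and $f\in\mathcal{B}$. If in addition (iii) $K(\cdot,y)\in\mathcal{B}$ for all $y\in\Omega'$, and (iv) $g(y)=\mathcal{J}[g](K(\cdot,y))$ for all $g\in\mathcal{G}$ and $y\in\Omega'$, then $\mathcal{B}$ is a right-sided GRKBS with right-sided reproducing kernel $K$. If both sets of conditions hold (i.e. (i)–(iv), with the same $\mathcal{G}$ and $\mathcal{J}$), $\mathcal{B}$ is a two-sided GRKBS and $K$ is its two-sided reproducing kernel. *)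

(* Defs.v *)
From HB Require Import structures.
From mathcomp Require Import all_boot all_order all_algebra.
From mathcomp Require Import generic_quotient ring_quotient complex.
From mathcomp Require Import mathcomp_extra boolp classical_sets functions reals.
From mathcomp Require Import topology tvs normedtype measurable_structure.

Set Implicit Arguments.
Unset Strict Implicit.
Unset Printing Implicit Defensive.

Import Order.TTheory GRing.Theory Num.Theory.
Import numFieldNormedType.Exports.

Local Open Scope classical_set_scope.
Local Open Scope ring_scope.

(* The scalar field of the Banach spaces: a numFieldType whose real elements
   are Dedekind complete.  The real and the complex numbers are instances. *)
HB.mixin Record NumField_isRealComplete K & Num.NumField K := {
  real_supremums : forall A : set K, (forall x, A x -> x \is Num.real) ->
    A !=set0 -> has_ubound A -> supremums A !=set0
}.

#[short(type="scalarFieldType")]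
HB.structure Definition ScalarField :=
  {K of Num.NumField K & NumField_isRealComplete K}.

Section real_scalars.
Variable R : realType.

Lemma realType_supremums (A : set R) : (forall x, A x -> x \is Num.real) ->
  A !=set0 -> has_ubound A -> supremums A !=set0.
Proof.
move=> _ A0 uA; exists (sup A); split; first exact: ub_le_sup.
by move=> y Ay; apply: ge_sup.
Qed.

#[non_forgetful_inheritance]
HB.instance Definition _ :=
  NumField_isRealComplete.Build (Real.sort R) realType_supremums.

Lemma complex_supremums (A : set R[i]) : (forall x, A x -> x \is Num.real) ->
  A !=set0 -> has_ubound A -> supremums A !=set0.
Proof.
move=> rA [a Aa] [b Ab].
have imE (x : R[i]) : x \is Num.real -> complex.Im x = 0.
  by rewrite realE !lecE /= => /orP[] /andP[/eqP].
have ubRe c : ubound A c -> ubound [set complex.Re x | x in A] (complex.Re c).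
  by move=> Ac _ [x Ax <-]; have := Ac _ Ax; rewrite lecE => /andP[].
have R0 : [set complex.Re x | x in A] !=set0 by exists (complex.Re a), a.
exists ((sup [set complex.Re x | x in A])%:C)%C; split=> [x Ax|c Ac].
  rewrite lecE /= imE ?eqxx ?rA//=; apply: ub_le_sup; last by exists x.
  by exists (complex.Re b); exact: ubRe.
have := Ac _ Aa; rewrite lecE (imE _ (rA _ Aa)) => /andP[/eqP cI _].
by rewrite lecE/= cI eqxx/=; apply: ge_sup => //; exact: ubRe.
Qed.

#[non_forgetful_inheritance]
HB.instance Definition _ :=
  NumField_isRealComplete.Build R[i] complex_supremums.

End real_scalars.


Section suprema.
Variable K : scalarFieldType.
Implicit Types A : set K.

Lemma supremum_ub A : (forall x, A x -> x \is Num.real) -> has_ubound A ->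
  forall x, A x -> x <= supremum 0 A.
Proof.
move=> rA uA x Ax; rewrite /supremum; case: ifPn => [/eqP A0|_].
  by move: Ax; rewrite A0.
have [y Ay] := real_supremums _ rA (ex_intro _ x Ax) uA.
by case: xgetP => [z _ [uz _]|/(_ y)//]; exact: uz.
Qed.

Lemma supremum_le A b : (forall x, A x -> x \is Num.real) -> A !=set0 ->
  ubound A b -> supremum 0 A <= b.
Proof.
move=> rA A0 Ab; rewrite /supremum; case: ifPn => [/eqP AE|_].
  by case: A0 => x; rewrite AE.
have [y Ay] := real_supremums _ rA A0 (ex_intro _ b Ab).
by case: xgetP => [z _ [_ lz]|/(_ y)//]; exact: lz.
Qed.

Let ge0_infimums A : (forall x, A x -> 0 <= x) -> A !=set0 -> infimums A !=set0.
Proof.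
move=> pA [a Aa].
have lr x : lbound A x -> x \is Num.real.
  by move=> Ax; rewrite (ler_real (Ax _ Aa)) ger0_real// pA.
have [||s [us ls]] := real_supremums _ lr; first by exists 0 => x /pA.
  by exists a => x; apply.
exists s; split; last exact: us.
by move=> x Ax; apply: ls => y; apply.
Qed.

Lemma infimum_lb A : (forall x, A x -> 0 <= x) -> forall x, A x -> infimum 0 A <= x.
Proof.
move=> pA x Ax; rewrite /infimum; case: ifPn => [/eqP A0|_].
  by move: Ax; rewrite A0.
have [y Ay] := ge0_infimums pA (ex_intro _ x Ax).
by case: xgetP => [z _ [lz _]|/(_ y)//]; exact: lz.
Qed.

Lemma le_infimum A b : (forall x, A x -> 0 <= x) -> A !=set0 ->
  lbound A b -> b <= infimum 0 A.
Proof.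
move=> pA A0 Ab; rewrite /infimum; case: ifPn => [/eqP AE|_].
  by case: A0 => x; rewrite AE.
have [y Ay] := ge0_infimums pA A0.
by case: xgetP => [z _ [_ uz]|/(_ y)//]; exact: uz.
Qed.

Lemma infimum_ge0 A : (forall x, A x -> 0 <= x) -> 0 <= infimum 0 A.
Proof.
move=> pA; have [->|/set0P A0] := eqVneq A set0; first by rewrite /infimum eqxx.
exact: le_infimum.
Qed.

End suprema.

Definition bounded_operator (K : numFieldType) (V W : normedModType K)
    (f : V -> W) : Prop :=
  exists M : K, forall v, `|f v| <= M * `|v|.

(* L_op(V, W): the bounded linear operators from V to W. *)
Section Lop.
Variables (K : scalarFieldType) (V W : normedModType K).

Definition Lop_pred : {pred V -> W} :=
  mem [set f : V -> W | linear f /\ bounded_operator f].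

Record Lop := MkLop { Lop_fun :> V -> W ; Lop_funP : Lop_fun \in Lop_pred }.

HB.instance Definition _ := [isSub for Lop_fun].
HB.instance Definition _ := [Choice of Lop by <:].

Lemma Lop_linear (T : Lop) : linear T.
Proof. by have := Lop_funP T; rewrite inE => -[]. Qed.

HB.instance Definition _ (T : Lop) :=
  GRing.isLinear.Build K V W *:%R (Lop_fun T) (@Lop_linear T).


Let ge0_bound (f : V -> W) : bounded_operator f ->
  exists2 M : K, 0 <= M & forall v, `|f v| <= M * `|v|.
Proof.
move=> [M fM]; exists `|M| => // v.
have := fM v => /[dup] /(le_trans (normr_ge0 _)) Mv.
by rewrite -(ger0_norm Mv) normrM normr_id.
Qed.

Lemma Lop_submod_closed : submod_closed Lop_pred.
Proof.
split=> [|a f g]; rewrite !inE.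
  split; first by move=> a u v /=; rewrite scaler0 addr0.
  by exists 0 => v; rewrite normr0 mul0r.
move=> [lf /ge0_bound[M M0 fM]] [lg /ge0_bound[N N0 gN]]; split.
  move=> b u v; rewrite !fctE lf lg !scalerDr !scalerA mulrC -!addrA.
  by congr (_ + _); rewrite addrCA.
exists (`|a| * M + N) => v; rewrite !fctE (le_trans (ler_normD _ _))//.
by rewrite mulrDl lerD// normrZ -mulrA ler_wpM2l.
Qed.

HB.instance Definition _ :=
  GRing.isSubmodClosed.Build K (V -> W) Lop_pred Lop_submod_closed.
HB.instance Definition _ := [SubChoice_isSubLmodule of Lop by <:].

(* The set below is nonempty, real and bounded, so supremum is its actual
   least upper bound and the default value 0 is never used. *)
Definition op_norm (T : Lop) : K :=
  supremum 0 [set `|T v| | v in [set v | `|v| <= 1]].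

Let op_set_real (T : Lop) x :
  [set `|T v| | v in [set v | `|v| <= 1]] x -> x \is Num.real.
Proof. by move=> [v _ <-]; exact: normr_real. Qed.

Let op_set_ub (T : Lop) :
  has_ubound [set `|T v| | v in [set v | `|v| <= 1]].
Proof.
have := Lop_funP T; rewrite inE => -[_ /ge0_bound[M M0 TM]].
by exists M => _ [v /= v1 <-]; rewrite (le_trans (TM v))// ler_piMr.
Qed.

Let op_set_neq0 (T : Lop) : [set `|T v| | v in [set v | `|v| <= 1]] !=set0.
Proof. by exists `|T 0|, 0 => //=; rewrite normr0. Qed.

Lemma op_norm_le (T : Lop) M : (forall v, `|v| <= 1 -> `|T v| <= M) ->
  op_norm T <= M.
Proof.
move=> TM; apply: (supremum_le (@op_set_real T) (op_set_neq0 T)).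
by move=> _ [v v1 <-]; exact: TM.
Qed.

Lemma ler_op_norm1 (T : Lop) v : `|v| <= 1 -> `|T v| <= op_norm T.
Proof.
by move=> v1; apply: (supremum_ub (@op_set_real T) (op_set_ub T)); exists v.
Qed.

Lemma op_norm_ge0 (T : Lop) : 0 <= op_norm T.
Proof. by rewrite (le_trans _ (@ler_op_norm1 T 0 _))// normr0. Qed.

Lemma ler_op_norm (T : Lop) v : `|T v| <= op_norm T * `|v|.
Proof.
have [->|v0] := eqVneq v 0; first by rewrite linear0 !normr0 mulr0.
have nv0 : `|v| != 0 by rewrite normr_eq0.
have nv_gt0 : 0 < `|v| by rewrite normr_gt0.
rewrite -ler_pdivrMr// -[`|v|]normr_id mulrC -normfV -normrZ -linearZ.
by apply: ler_op_norm1; rewrite normrZ normfV normr_id mulVf.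
Qed.

Lemma op_normD (S T : Lop) : op_norm (S + T) <= op_norm S + op_norm T.
Proof.
apply: op_norm_le => v v1; rewrite (le_trans (ler_normD _ _))//.
by rewrite lerD// ler_op_norm1.
Qed.

Let op_normZ_le a (T : Lop) : op_norm (a *: T) <= `|a| * op_norm T.
Proof.
by apply: op_norm_le => v v1; rewrite normrZ ler_wpM2l// ler_op_norm1.
Qed.

Lemma op_normZ a (T : Lop) : op_norm (a *: T) = `|a| * op_norm T.
Proof.
have [->|a0] := eqVneq a 0.
  apply/le_anti; rewrite op_normZ_le normr0 mul0r; exact: op_norm_ge0.
apply/le_anti; rewrite op_normZ_le /=.
rewrite -ler_pdivlMl ?normr_gt0// -normfV (le_trans _ (op_normZ_le _ _))//.
by rewrite scalerA mulVf// scale1r.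
Qed.

Lemma op_norm0_eq0 (T : Lop) : op_norm T = 0 -> T = 0.
Proof.
move=> T0; apply/val_inj/funext => v; apply/eqP; rewrite -normr_le0.
by rewrite (le_trans (ler_op_norm T v))// T0 mul0r.
Qed.

HB.instance Definition _ :=
  Lmodule_isNormed.Build K Lop op_normD op_normZ op_norm0_eq0.

End Lop.

(* F / N_phi, with the quotient norm and the topology it induces. *)
Section quotient.
Local Open Scope quotient_scope.
Variables (K : scalarFieldType) (X : Type) (E F : normedModType K).
Variable phi : X -> Lop F E.

Definition common_ker : {pred F} :=
  mem (\bigcap_(x in [set: X]) [set mu : F | phi x mu = 0]).

Lemma common_kerP mu : reflect (forall x, phi x mu = 0) (mu \in common_ker).
Proof.
by apply: (iffP idP); rewrite inE => H x; [exact: (H x)|move=> _; exact: H].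
Qed.

Lemma common_ker_submod_closed : submod_closed common_ker.
Proof.
split=> [|a u v /common_kerP u0 /common_kerP v0]; apply/common_kerP => x.
  by rewrite linear0.
by rewrite linearP/= u0 v0 scaler0 addr0.
Qed.

HB.instance Definition _ :=
  GRing.isSubmodClosed.Build K F common_ker common_ker_submod_closed.

Definition ker_quot : Type := Quotient.quot common_ker.

HB.instance Definition _ := EqQuotient.on ker_quot.
HB.instance Definition _ := Choice.on ker_quot.
HB.instance Definition _ := GRing.Zmodule.on ker_quot.

Definition ker_coset (mu : F) : ker_quot := \pi_ker_quot mu.

Lemma ker_cosetP mu nu :
  ker_coset mu = ker_coset nu <-> forall x, phi x mu = phi x nu.
Proof.
split=> [/eqP|H].
  rewrite -Quotient.idealrBE => /common_kerP H x.
  by apply/eqP; rewrite -subr_eq0; have := H x; rewrite linearB => ->.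
apply/eqP; rewrite -Quotient.idealrBE; apply/common_kerP => x.
by rewrite linearB/= H subrr.
Qed.

Lemma ker_coset_repr q : ker_coset (repr q) = q.
Proof. exact: reprK. Qed.

Lemma ker_cosetD mu nu : ker_coset (mu + nu) = ker_coset mu + ker_coset nu.
Proof. exact: (Quotient.pi_add common_ker). Qed.

Lemma ker_coset0 : ker_coset 0 = 0.
Proof. by apply: (@addrI _ (ker_coset 0)); rewrite -ker_cosetD !addr0. Qed.

Definition quot_scale (a : K) (q : ker_quot) : ker_quot :=
  ker_coset (a *: repr q).

Let phi_repr mu x : phi x (repr (ker_coset mu)) = phi x mu.
Proof. by move: x; apply/ker_cosetP; rewrite ker_coset_repr. Qed.

Lemma quot_scaleE a mu : quot_scale a (ker_coset mu) = ker_coset (a *: mu).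
Proof. by apply/ker_cosetP => x; rewrite !linearZ /= phi_repr. Qed.

Let scaleA a b q : quot_scale a (quot_scale b q) = quot_scale (a * b) q.
Proof. by rewrite -[q]ker_coset_repr !quot_scaleE scalerA. Qed.
Let scale1 : left_id 1 quot_scale.
Proof. by move=> q; rewrite -[q]ker_coset_repr quot_scaleE scale1r. Qed.
Let scaleDr : right_distributive quot_scale +%R.
Proof.
move=> a p q; rewrite -[q]ker_coset_repr -[p]ker_coset_repr.
by rewrite -ker_cosetD !quot_scaleE -ker_cosetD scalerDr.
Qed.
Let scaleDl q : {morph quot_scale^~ q : a b / a + b}.
Proof.
by move=> a b; rewrite -[q]ker_coset_repr !quot_scaleE -ker_cosetD scalerDl.
Qed.

HB.instance Definition _ :=
  GRing.Zmodule_isLmodule.Build K ker_quot scaleA scale1 scaleDr scaleDl.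

Lemma ker_coset_linear : linear ker_coset.
Proof. by move=> a u v; rewrite ker_cosetD -quot_scaleE. Qed.

Definition quot_norm (q : ker_quot) : K :=
  infimum 0 [set `|mu| | mu in [set mu : F | ker_coset mu = q]].

Let qset_ge0 q x :
  [set `|mu| | mu in [set mu : F | ker_coset mu = q]] x -> 0 <= x.
Proof. by move=> [mu _ <-]. Qed.

Let qset_neq0 q : [set `|mu| | mu in [set mu : F | ker_coset mu = q]] !=set0.
Proof. by exists `|repr q|, (repr q) => //=; exact: ker_coset_repr. Qed.

Lemma quot_norm_ge0 q : 0 <= quot_norm q.
Proof. exact: infimum_ge0 (@qset_ge0 q). Qed.

Lemma quot_norm_le mu : quot_norm (ker_coset mu) <= `|mu|.
Proof. by apply: (infimum_lb (@qset_ge0 _)); exists mu. Qed.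

Lemma le_quot_norm q b :
  (forall mu, ker_coset mu = q -> b <= `|mu|) -> b <= quot_norm q.
Proof.
move=> bq; apply: (le_infimum (@qset_ge0 q) (@qset_neq0 q)).
by move=> _ [mu muq <-]; exact: bq.
Qed.

Lemma quot_normD p q : quot_norm (p + q) <= quot_norm p + quot_norm q.
Proof.
rewrite -lerBlDr; apply: le_quot_norm => mu <-.
rewrite lerBlDr -lerBlDl; apply: le_quot_norm => nu <-.
by rewrite lerBlDl -ker_cosetD (le_trans (quot_norm_le _))// ler_normD.
Qed.

Let quot_normZ_le a q : quot_norm (a *: q) <= `|a| * quot_norm q.
Proof.
have [->|a0] := eqVneq a 0.
  rewrite normr0 mul0r -[q]ker_coset_repr -[_ *: _]/(quot_scale _ _) quot_scaleE.
  by rewrite (le_trans (quot_norm_le _))// scale0r normr0.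
rewrite -ler_pdivrMl ?normr_gt0//; apply: le_quot_norm => mu <-.
rewrite ler_pdivrMl ?normr_gt0// -normrZ -[_ *: ker_coset _]/(quot_scale _ _).
by rewrite quot_scaleE quot_norm_le.
Qed.

Lemma quot_normZ a q : quot_norm (a *: q) = `|a| * quot_norm q.
Proof.
have [->|a0] := eqVneq a 0.
  apply/le_anti; rewrite quot_normZ_le normr0 mul0r; exact: quot_norm_ge0.
apply/le_anti; rewrite quot_normZ_le /=.
rewrite -ler_pdivlMl ?normr_gt0// -normfV (le_trans _ (quot_normZ_le _ _))//.
by rewrite scalerA mulVf// scale1r.
Qed.

Lemma quot_norm0_eq0 q : quot_norm q = 0 -> q = 0.
Proof.
rewrite -[q]ker_coset_repr; set mu := repr q => q0.
rewrite -ker_coset0; apply/ker_cosetP => x.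
rewrite linear0; apply/eqP; rewrite -normr_le0.
have ge0c := op_norm_ge0 (phi x).
have [c0|c0] := eqVneq (op_norm (phi x)) 0.
  by rewrite (le_trans (ler_op_norm _ _))// c0 mul0r.
have c_gt0 : 0 < op_norm (phi x) by rewrite lt0r c0.
rewrite -(@ler_pM2l _ (op_norm (phi x))^-1) ?invr_gt0// mulr0 -q0.
apply: le_quot_norm => nu /ker_cosetP <-.
by rewrite ler_pdivrMl// ler_op_norm.
Qed.

HB.instance Definition _ :=
  Lmodule_isNormed.Build K ker_quot quot_normD quot_normZ quot_norm0_eq0.

End quotient.

(* A vector space [V] whose elements [v] are the functions [ev v : Y -> W],
   with pointwise operations: two elements with the same values are equal. *)
Definition function_space (K : scalarFieldType) (Y : Type)
    (V W : normedModType K) (ev : V -> Y -> W) : Prop :=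
  linear ev /\ injective ev.

Record banachFunSpace (K : scalarFieldType) (X : Type)
    (E : completeNormedModType K) := BanachFunSpace {
  bfs_car :> completeNormedModType K ;
  bfs_ev : bfs_car -> X -> E ;
  bfs_evP : function_space bfs_ev }.

Section GRKBS.
Local Open Scope quotient_scope.
Variables (K : scalarFieldType) (X : Type) (E : completeNormedModType K).

Definition is_GRKBS (B : banachFunSpace X E) : Prop :=
  forall x, bounded_operator (fun f : B => bfs_ev f x).

Definition f_ (F : completeNormedModType K) (phi : X -> Lop F E) (mu : F) :
  X -> E := fun x => phi x mu.

Definition configuration (B : banachFunSpace X E)
    (F : completeNormedModType K) (phi : X -> Lop F E) : Prop :=
  range (@bfs_ev _ _ _ B) = range (f_ phi) /\
  forall f : B,
    `|f| = infimum 0 [set `|mu| | mu in [set mu | bfs_ev f = f_ phi mu]].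

(* phi_star (mu + N_phi) is the element f_mu of B; the choice of representative
   is irrelevant by ker_cosetP, and for a configuration f_mu is always in B, so
   the default 0 is never used. *)
Definition phi_star (B : banachFunSpace X E) (F : completeNormedModType K)
    (phi : X -> Lop F E) (q : ker_quot phi) : B :=
  xget 0 [set f : B | bfs_ev f = f_ phi (repr q)].

Definition quot_kernel (B : banachFunSpace X E) (F : completeNormedModType K)
    (phi : X -> Lop F E) (x : X) (q : ker_quot phi) : E :=
  bfs_ev (phi_star B q) x.

End GRKBS.

(* Measurability for the Borel sigma-algebras. *)
Definition borel_measurable (Y Z : topologicalType) (g : Y -> Z) : Prop :=
  forall A : set Z, <<s @open Z >> A -> <<s @open Y >> (g @^-1` A).

Definition isometric_isomorphism (K : numFieldType) (V W : normedModType K)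
    (J : V -> W) : Prop :=
  [/\ linear J, bijective J & forall v, `|J v| = `|v| ].

Section sided_kernels.
Variables (K : scalarFieldType) (Om : Type) (Om' : topologicalType).
Variables (E : completeNormedModType K) (B : banachFunSpace Om E).
Variable Kr : Om -> Om' -> E.

(* Membership of a function h in a function space (V, ev) reads
   [exists v, ev v = h], and this v is unique. *)
Definition left_sided_conditions (G : normedModType K) (evG : G -> Om' -> E)
    (J : G -> Lop B E) : Prop :=
  [/\ function_space evG,
      forall x, exists g : G, evG g = Kr x,
      isometric_isomorphism J
    & forall x (g : G), evG g = Kr x -> forall f : B, bfs_ev f x = J g f].

Definition right_sided_conditions (G : normedModType K) (evG : G -> Om' -> E)
    (J : G -> Lop B E) : Prop :=
  (forall y, exists k : B, bfs_ev k = Kr^~ y) /\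
  (forall y (k : B), bfs_ev k = Kr^~ y -> forall g : G, evG g y = J g k).

Definition two_sided_GRKBS : Prop :=
  [/\ hausdorff_space Om',
      forall x, borel_measurable (Kr x)
    & exists (G : normedModType K) (evG : G -> Om' -> E) (J : G -> Lop B E),
        left_sided_conditions evG J /\ right_sided_conditions evG J].

End sided_kernels.

(* Main.v *)
From HB Require Import structures.
Require Import Defs.
From mathcomp Require Import all_boot all_order all_algebra.
From mathcomp Require Import boolp classical_sets functions reals.
From mathcomp Require Import topology tvs normedtype measurable_structure.

Set Implicit Arguments.
Unset Strict Implicit.
Unset Printing Implicit Defensive.

(* Take G to be all of L_op(B, E), an operator T acting on F / N_phi as
   q |-> T (phi_star q), and J = id.  This is faithful because phi_star is onto
   B; K(x, .) is then the evaluation ev_x, and K(., q) is phi_star q. *)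

Import Order.TTheory GRing.Theory Num.Theory numFieldNormedType.Exports.
Local Open Scope classical_set_scope.
Local Open Scope ring_scope.

(** The sets with Borel preimage form a sigma-algebra; by continuity it contains every open set,
    hence every Borel set. *)
Lemma continuous_borel_measurable (Y Z : topologicalType) (g : Y -> Z) :
  continuous g -> borel_measurable g.
Proof.
move=> /continuousP gO A; rewrite -[g @^-1` A]setTI.
apply: (smallest_sub (X := image_set_system setT g <<s @open Y >>)).
  exact/sigma_algebra_image/smallest_sigma_algebra.
by move=> U /gO gU; rewrite /image_set_system/= setTI; exact: sub_sigma_algebra.
Qed.

Lemma bounded_operator_continuous (K : numFieldType) (V W : normedModType K)
    (g : V -> W) : linear g -> bounded_operator g -> continuous g.
Proof.
move=> g_linear [M gM].
pose gL := GRing.isLinear.Build K V W *:%R g g_linear.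
pose gl : {linear V -> W} := HB.pack g gL.
apply: (@bounded_linear_continuous _ _ _ gl); apply/linear_boundedP.
(* [M] may be negative or not real, whereas the threshold must be real. The product of [M] and the
   norm of [v] bounds a norm, so it is nonnegative and [M] can be replaced by its absolute value. *)
exists `|M|; split; first exact: normr_real.
move=> r Mr v.
have := gM v => /[dup] /(le_trans (normr_ge0 _)) Mv0 /le_trans; apply.
by rewrite -(ger0_norm Mv0) normrM normr_id ler_wpM2r// ltW.
Qed.

Section configuration.
Variables (K : scalarFieldType) (X : Type) (E : completeNormedModType K).
Variables (B : banachFunSpace X E) (F : completeNormedModType K).
Variable phi : X -> Lop F E.

Lemma bfs_ev_linear : linear (@bfs_ev _ _ _ B).
Proof. by case: (bfs_evP B). Qed.

Lemma bfs_ev_inj : injective (@bfs_ev _ _ _ B).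
Proof. by case: (bfs_evP B). Qed.

Hypothesis Bphi : configuration B phi.

(** The representative chosen in [phi_star] differs from [mu] by an element of the common kernel,
    and the range equality in [configuration] puts the function in [B], so [xget] does not return
    its default. *)
Lemma bfs_ev_phi_star (mu : F) :
  bfs_ev (phi_star B (ker_coset phi mu)) = f_ phi mu.
Proof.
have repr_mu : f_ phi (repr (ker_coset phi mu)) = f_ phi mu.
  by apply/funext; apply/ker_cosetP; rewrite ker_coset_repr.
have [f _ fmu] : range (@bfs_ev _ _ _ B) (f_ phi mu).
  by rewrite (proj1 Bphi); exists mu.
rewrite /phi_star repr_mu; case: xgetP => [h _ //|/(_ f)]; exact: absurd.
Qed.

Lemma quot_kernelE x (mu : F) : quot_kernel B x (ker_coset phi mu) = phi x mu.
Proof. by rewrite /quot_kernel bfs_ev_phi_star. Qed.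

Lemma phi_star_linear : linear (@phi_star _ _ _ B _ phi).
Proof.
move=> a p q; rewrite -[p]ker_coset_repr -[q]ker_coset_repr.
rewrite -(ker_coset_linear phi); apply: bfs_ev_inj.
rewrite bfs_ev_linear !bfs_ev_phi_star; apply/funext => x.
exact: (Lop_linear (phi x)).
Qed.

Lemma phi_star_surj (f : B) : exists q : ker_quot phi, phi_star B q = f.
Proof.
have [mu _ fmu] : range (f_ phi) (bfs_ev f) by rewrite -(proj1 Bphi); exists f.
by exists (ker_coset phi mu); apply: bfs_ev_inj; rewrite bfs_ev_phi_star.
Qed.

(** The operator norm of [phi x] is a bound: the estimate holds for every representative of [q],
    hence for the infimum of their norms. *)
Lemma quot_kernel_continuous x : continuous (@quot_kernel _ _ _ B _ phi x).
Proof.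
apply: bounded_operator_continuous => [a p q|].
  by rewrite /quot_kernel phi_star_linear bfs_ev_linear.
exists (op_norm (phi x)) => q.
(* A zero norm is treated apart, since passing to the infimum divides by it. *)
have [c0|c0] := eqVneq (op_norm (phi x)) 0.
  rewrite -{1}[q]ker_coset_repr quot_kernelE c0 mul0r.
  by rewrite (le_trans (ler_op_norm _ _))// c0 mul0r.
have c_gt0 : 0 < op_norm (phi x) by rewrite lt0r c0 op_norm_ge0.
rewrite -ler_pdivrMl//; apply: le_quot_norm => mu <-.
by rewrite quot_kernelE ler_pdivrMl// ler_op_norm.
Qed.

End configuration.

Theorem theorem11 (K : scalarFieldType) (X : Type)
    (E : completeNormedModType K) (B : banachFunSpace X E)
    (F : completeNormedModType K) (phi : X -> Lop F E) :
  is_GRKBS B -> configuration B phi ->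
  (forall x (mu : F), quot_kernel B x (ker_coset phi mu) = phi x mu) /\
  two_sided_GRKBS B (@quot_kernel K X E B F phi).
Proof.
move=> evB Bphi; split; first exact: quot_kernelE.
split; first exact: norm_hausdorff.
  by move=> x; apply: continuous_borel_measurable; exact: quot_kernel_continuous.
exists (Lop B E), (fun (T : Lop B E) (q : ker_quot phi) => T (phi_star B q)), id; split; split.
- split; first by [].
  move=> S T ST; apply/val_inj/funext => f.
  by have [q <-] := phi_star_surj Bphi f; exact: (congr1 (@^~ q) ST).
- move=> x.
  (* The GRKBS hypothesis, boundedness of evaluation at [x], is what puts K(x, .) in G. *)
  have ev_in : (fun f : B => bfs_ev f x) \in @Lop_pred K B E.
    by rewrite inE; split=> [a f g|]; [rewrite bfs_ev_linear|exact: evB].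
  by exists (MkLop ev_in).
- by split=> //; exists id.
(* By [Tx], [T] agrees with evaluation at [x] on the image of [phi_star], which is all of [B]. *)
- move=> x T Tx f; have [q <-] := phi_star_surj Bphi f.
  exact: esym (congr1 (@^~ q) Tx).
- by move=> q; exists (phi_star B q).
(* [k] has the same values as [phi_star B q], hence equals it. *)
- by move=> q k kq T; congr (T _); apply: bfs_ev_inj; rewrite kq.
Qed.
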